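(* Let $q=p^n\ge3$ with $p$ prime, let $r\in\mathbb{F}_q^*$ and $b=r^{p-1}$ (an $\frac{p^n-1}{p-1}$-th root of unity). Let $V[x]$ be the $\mathbb{F}_q$-vector space of polynomials $f\in\mathbb{F}_q[x]$ of degree at most $q-2$ with $f(0)=0$, and let $A_r:V[x]\to V[x]$ be the linear map $A_r(f)(x)=f(x+r)-f(r)$. Then the eigenspace $\ker(A_r-I)$ is spanned by the monomials $x,x^p,x^{p^2},\ldots,x^{p^{n-1}}$ and the polynomials $(x^p-bx)^i$ for $i=2,\ldots,p^{n-1}-1$ with $i$ not a power of $p$.
   Context: Polynomials in $V[x]$ are formal polynomials; $f(x+r)$ denotes formal substitution; $I$ is the identity map of $V[x]$. *)

(* Defs.v *)
From HB Require Import structures.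
From mathcomp Require Import all_boot all_order all_algebra all_field.

Set Implicit Arguments.
Unset Strict Implicit.
Unset Printing Implicit Defensive.

Import GRing.Theory.
Local Open Scope ring_scope.

Section VSpace.
Variables (F : fieldType) (q : nat).

(* [size f <= q.-1] means that f has degree at most q - 2 (or is 0), for q >= 2. *)
Definition eval0 (f : {poly_(q.-1) F}) : F^o := (f : {poly F}).[0].

Lemma eval0_is_linear : linear eval0.
Proof. by move=> a f g; rewrite /eval0 /= hornerD hornerZ. Qed.

HB.instance Definition _ :=
  GRing.isLinear.Build F {poly_(q.-1) F} F^o _ eval0 eval0_is_linear.

Definition Vx_space : {vspace {poly_(q.-1) F}} := lker (linfun eval0).

Definition Vx := subvs_of Vx_space.

HB.instance Definition _ := Vector.on Vx.

Definition Vx_poly (f : Vx) : {poly F} := polyn (vsval f).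

Lemma mem_Vx_space (f : {poly_(q.-1) F}) :
  (f \in Vx_space) = ((f : {poly F}).[0] == 0).
Proof. by rewrite memv_ker lfunE. Qed.

Lemma Vx_poly_inj : injective Vx_poly.
Proof. by move=> f g /val_inj/val_inj. Qed.

Lemma Vx_polyP (g : {poly F}) :
  (exists f : Vx, Vx_poly f = g) <-> (size g <= q.-1)%N /\ g.[0] = 0.
Proof.
split=> [[f <-]|[sg g0]].
  split; first exact: size_npoly.
  by apply/eqP; rewrite -mem_Vx_space; apply: subvsP.
have gV : NPoly (sg : g \is a poly_of_size _) \in Vx_space.
  by rewrite mem_Vx_space /= g0.
by exists (Subvs gV).
Qed.

Section Shift.
Variable r : F.

Definition shift_poly (f : {poly F}) : {poly F} :=
  f \Po ('X + r%:P) - f.[r]%:P.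

Lemma size_shift_poly (f : Vx) :
  shift_poly (Vx_poly f) \is a poly_of_size q.-1.
Proof.
have sf : (size (Vx_poly f) <= q.-1)%N by exact: size_npoly.
rewrite qualifE /= /shift_poly.
have [->|f0] := eqVneq (Vx_poly f) 0.
  by rewrite comp_poly0 horner0 subr0 size_poly0.
apply: leq_trans (size_polyD _ _) _.
rewrite geq_max size_polyN size_comp_poly2 ?size_XaddC // sf /=.
apply: leq_trans (size_polyC_leq1 _) (leq_trans _ sf).
by rewrite size_poly_gt0.
Qed.

Lemma shift_poly_mem (f : Vx) : NPoly (size_shift_poly f) \in Vx_space.
Proof.
rewrite mem_Vx_space /= /shift_poly hornerD hornerN horner_comp !hornerE.
by rewrite subrr.
Qed.

Definition A_fun (f : Vx) : Vx := Subvs (shift_poly_mem f).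

Lemma A_fun_is_linear : linear A_fun.
Proof.
move=> a f g; apply: Vx_poly_inj; rewrite /Vx_poly /= /shift_poly.
rewrite comp_polyD comp_polyZ hornerD hornerZ polyCD polyCM.
by rewrite scalerBr -mul_polyC -[in RHS](mul_polyC _ (_%:P)) opprD addrACA.
Qed.

HB.instance Definition _ := GRing.isLinear.Build F Vx Vx _ A_fun A_fun_is_linear.

Definition A_map : 'End(Vx) := linfun A_fun.

Lemma A_mapE (f : Vx) :
  Vx_poly (A_map f) = Vx_poly f \Po ('X + r%:P) - (Vx_poly f).[r]%:P.
Proof. by rewrite lfunE. Qed.

End Shift.
End VSpace.

(* For p > 1, an exponent k with i = p ^ k satisfies k < i (see [is_powerP]). *)
Definition is_power (p i : nat) : bool := [exists k : 'I_i, i == (p ^ k)%N].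

Lemma is_powerP (p i : nat) : (1 < p)%N ->
  reflect (exists k, i = (p ^ k)%N) (is_power p i).
Proof.
move=> p1; apply: (iffP existsP) => [[k /eqP ->]|[k ik]]; first by exists k.
have ki : (k < i)%N by rewrite ik ltn_expl.
by exists (Ordinal ki); apply/eqP.
Qed.

Section Generators.
Variables (F : fieldType) (p n : nat) (b : F).

Definition p_monomials : seq {poly F} := [seq 'X^(p ^ j) | j <- iota 0 n].

Definition p_binomial_powers : seq {poly F} :=
  [seq ('X^p - b *: 'X) ^+ i | i <- index_iota 2 (p ^ n.-1) & ~~ is_power p i].

End Generators.

(* Main.v *)
Require Import Defs.
From HB Require Import structures.
From mathcomp Require Import all_boot all_order all_algebra all_field.
From mathcomp Require Import zify.

(** Write [g = x^p - r^(p-1) x], a polynomial invariant under [x -> x + r].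
    An [r]-periodic [f] takes the value [f 0] at the [p] points [k r], which are
    the roots of [g]; hence [f = f 0 + h g] with [h] again [r]-periodic, and by
    induction [f] is a polynomial in [g].  If [f (x + r) = f x + f r], then
    [f - (f r / r) x] is [r]-periodic, so it is a combination of powers of [g].
    The powers [g^(p^k)] are redundant: the Frobenius map turns them into
    combinations of [x^(p^k)] and [x^(p^(k+1))]. *)

Set Implicit Arguments.
Unset Strict Implicit.
Unset Printing Implicit Defensive.

Import GRing.Theory.
Local Open Scope ring_scope.

Lemma ltn_exp_gt0 p n : (1 < p ^ n)%N -> (0 < n)%N.
Proof. by case: n. Qed.

Lemma ltn_succ_exp p k n :
  (1 < p)%N -> (2 < p ^ n)%N -> (k < n)%N -> ((p ^ k).+1 < p ^ n)%N.
Proof.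
move=> p_gt1 q_gt2 lt_kn.
have : (2 * p ^ k <= p ^ n)%N.
  apply: (@leq_trans (p ^ k.+1)); first by rewrite expnS leq_mul2r p_gt1 orbT.
  by rewrite leq_exp2l.
lia.
Qed.

Lemma expf_unity_root (F : finFieldType) (x : F) d :
  x != 0 -> (d %| #|F|.-1)%N -> (#|F|.-1 %/ d)%N.-unity_root (x ^+ d).
Proof.
move=> x_neq0 d_dvd; rewrite unity_rootE -exprM mulnC divnK //.
apply/eqP/(mulIf x_neq0); rewrite mul1r -exprSr prednK ?expf_card //.
by apply/card_gt0P; exists x.
Qed.

Lemma pchar_pnat_exp (R : nzSemiRingType) p k :
  p \in [pchar R] -> [pchar R].-nat (p ^ k)%N.
Proof.
move=> pcharRp; rewrite pnatX (eq_pnat _ (pcharf_eq pcharRp)).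
by rewrite pnat_id ?(pcharf_prime pcharRp).
Qed.

Lemma eqr_nat_pchar (R : nzRingType) p m n : p \in [pchar R] ->
  (m%:R == n%:R :> R) = (m == n %[mod p])%N.
Proof.
move=> pcharRp; wlog le_nm : m n / (n <= m)%N => [sym|].
  by case/orP: (leq_total n m) => /sym // sym_mn; rewrite eq_sym sym_mn eq_sym.
by rewrite eqn_mod_dvd // (dvdn_pcharf pcharRp) natrB // subr_eq0.
Qed.

Lemma uniq_mulrn_pchar (R : idomainType) p (r : R) :
  p \in [pchar R] -> r != 0 -> uniq [seq r *+ k | k <- iota 0 p].
Proof.
move=> pcharRp r_neq0; rewrite map_inj_in_uniq ?iota_uniq // => i j.
rewrite !mem_iota /= => lt_ip lt_jp.
rewrite -(mulr_natl r i) -(mulr_natl r j) => /(mulIf r_neq0)/eqP.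
by rewrite (eqr_nat_pchar _ _ pcharRp) !modn_small // => /eqP.
Qed.

Definition p_binomial (R : nzRingType) p (b : R) : {poly R} :=
  'X^p - b *: 'X.

Lemma size_p_binomial (R : nzRingType) p (b : R) :
  (1 < p)%N -> size (p_binomial p b) = p.+1.
Proof.
move=> p_gt1; rewrite size_polyDl size_polyXn // size_polyN.
by rewrite (leq_ltn_trans (size_scale_leq _ _)) // size_polyX.
Qed.

Lemma size_comp_p_binomial_leq (R : idomainType) p (b : R) (h : {poly R}) m :
    (1 < p)%N -> (0 < m)%N ->
  (size (h \Po p_binomial p b) <= m * p)%N -> (size h <= m)%N.
Proof.
move=> p_gt1 m_gt0 size_hg; have p_gt0 := ltnW p_gt1.
apply: leq_trans (leqSpred _) _; rewrite -(ltn_pmul2r p_gt0).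
have := size_comp_poly h (p_binomial p b); rewrite size_p_binomial //= => <-.
by rewrite -[ltnRHS]prednK ?muln_gt0 ?m_gt0 // ltnS -!subn1 leq_sub2r.
Qed.

Lemma lead_coef_p_binomial (R : nzRingType) p (b : R) :
  (1 < p)%N -> lead_coef (p_binomial p b) = 1.
Proof.
move=> p_gt1; rewrite lead_coefE size_p_binomial // coefB coefXn coefZ coefX.
by rewrite eqxx eqn_leq leqNgt p_gt1 mulr0 subr0.
Qed.

Lemma horner0_p_binomial (R : nzRingType) p (b : R) :
  (0 < p)%N -> (p_binomial p b).[0] = 0.
Proof.
by move=> p_gt0; rewrite !hornerE hornerXn expr0n eqn0Ngt p_gt0 subrr.
Qed.

Section Frobenius.
Variables (R : comNzRingType) (p : nat).
Hypothesis pcharRp : p \in [pchar R].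

Let pnat_poly k : [pchar {poly R}].-nat (p ^ k)%N.
Proof. by rewrite pchar_pnat_exp // pchar_poly. Qed.

Lemma comp_Xn_pchar_shift k (t : R) :
  'X^(p ^ k) \Po ('X + t%:P) = 'X^(p ^ k) + (t ^+ (p ^ k))%:P.
Proof. by rewrite comp_Xn_poly exprDn_pchar // -polyC_exp. Qed.

Lemma comp_p_binomial_shift (b t : R) :
  p_binomial p b \Po ('X + t%:P) = p_binomial p b + ((p_binomial p b).[t])%:P.
Proof.
have shift_Xp := comp_Xn_pchar_shift 1 t; rewrite expn1 in shift_Xp.
rewrite comp_polyB comp_polyZ comp_polyX shift_Xp !hornerE.
by rewrite polyCB polyCM mul_polyC scalerDr opprD addrACA.
Qed.

Lemma p_binomial_exp_pchar (b : R) k :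
  p_binomial p b ^+ (p ^ k) = 'X^(p ^ k.+1) - b ^+ (p ^ k) *: 'X^(p ^ k).
Proof. by rewrite exprDn_pchar // exprNn_pchar // exprZn -exprM -expnS. Qed.

End Frobenius.

Definition shift_periodic (R : nzRingType) (t : R) (f : {poly R}) : Prop :=
  f \Po ('X + t%:P) = f.

Lemma shift_periodic_horner (R : comNzRingType) (t : R) (f : {poly R}) k :
  shift_periodic t f -> f.[t *+ k] = f.[0].
Proof.
move=> f_periodic; elim: k => // k IHk.
by rewrite -IHk -[in RHS]f_periodic horner_comp !hornerE mulrSr.
Qed.

Section PeriodicPolynomials.
Variables (F : fieldType) (p : nat) (r : F).
Hypotheses (pcharFp : p \in [pchar F]) (r_neq0 : r != 0).

Let p_gt1 : (1 < p)%N := prime_gt1 (pcharf_prime pcharFp).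
Let p_gt0 : (0 < p)%N := ltnW p_gt1.

Local Notation g := (p_binomial p (r ^+ (p - 1))).
Local Notation multiples := [seq r *+ k | k <- iota 0 p].

Let p_binomial_neq0 : g != 0.
Proof. by rewrite -size_poly_eq0 size_p_binomial. Qed.

Lemma p_binomial_periodic : shift_periodic r g.
Proof.
rewrite /shift_periodic comp_p_binomial_shift // !hornerE.
by rewrite -exprSr subn1 prednK // subrr addr0.
Qed.

Lemma comp_p_binomial_periodic (h : {poly F}) : shift_periodic r (h \Po g).
Proof. by rewrite /shift_periodic -comp_polyA p_binomial_periodic. Qed.

Lemma periodic_root_multiples (f : {poly F}) :
  shift_periodic r f -> f.[0] = 0 -> all (root f) multiples.
Proof.
move=> f_periodic f0; apply/allP => _ /mapP[k _ ->].
by rewrite /root shift_periodic_horner ?f0.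
Qed.

Lemma p_binomial_prod : g = \prod_(z <- multiples) ('X - z%:P).
Proof.
rewrite -[RHS]scale1r -(lead_coef_p_binomial (r ^+ (p - 1)) p_gt1).
apply: all_roots_prod_XsubC.
- by rewrite size_p_binomial // size_map size_iota.
- apply: periodic_root_multiples p_binomial_periodic _.
  exact: horner0_p_binomial.
- by rewrite uniq_rootsE uniq_mulrn_pchar.
Qed.

Lemma periodic_p_binomial_factor (f : {poly F}) :
    shift_periodic r f -> f.[0] = 0 ->
  exists2 h, shift_periodic r h & f = h * g.
Proof.
move=> f_periodic f0.
have [|h] := uniq_roots_prod_XsubC (periodic_root_multiples f_periodic f0).
  by rewrite uniq_rootsE uniq_mulrn_pchar.
rewrite -p_binomial_prod => f_eq; exists h => //.
apply: (mulIf p_binomial_neq0).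
by rewrite -{1}p_binomial_periodic -comp_polyM -f_eq.
Qed.

Lemma periodic_comp_p_binomial (f : {poly F}) :
  shift_periodic r f -> exists h, f = h \Po g.
Proof.
have [m] := ubnP (size f); elim: m f => // m IHm f /ltnSE le_fm f_periodic.
have [||k k_periodic k_eq] := @periodic_p_binomial_factor (f - f.[0]%:P).
- by rewrite /shift_periodic comp_polyB comp_polyC f_periodic.
- by rewrite !hornerE subrr.
have f_eq : f = k * g + f.[0]%:P by rewrite -k_eq subrK.
have [k0|k_neq0] := eqVneq k 0.
  by exists f.[0]%:P; rewrite comp_polyC {1}f_eq k0 mul0r add0r.
have lt_kf : (size k < size f)%N.
  have size_kg : size (k * g) = (size k + p)%N.
    by rewrite size_mul // size_p_binomial // addnS.
  rewrite f_eq size_polyDl size_kg; first by rewrite -addn1 leq_add2l.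
  rewrite (leq_ltn_trans (size_polyC_leq1 _)) //.
  by rewrite (leq_trans p_gt1) ?leq_addl.
have [h h_eq] := IHm k (leq_trans lt_kf le_fm) k_periodic.
exists (h * 'X + f.[0]%:P).
by rewrite comp_polyD comp_polyM comp_polyX comp_polyC -h_eq -f_eq.
Qed.

Lemma shift_addC_comp_p_binomial (f : {poly F}) a :
    f \Po ('X + r%:P) = f + a%:P ->
  exists h, f = h \Po g + (a / r) *: 'X.
Proof.
move=> f_shift.
have [|h h_eq] := @periodic_comp_p_binomial (f - (a / r) *: 'X).
  rewrite /shift_periodic comp_polyB comp_polyZ comp_polyX f_shift scalerDr.
  by rewrite -[_ *: r%:P]mul_polyC -polyCM divfK // opprD addrACA subrr addr0.
by exists h; rewrite -h_eq subrK.
Qed.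

End PeriodicPolynomials.

Section PolynomialsToVx.
Variables (F : fieldType) (q : nat).

(* A polynomial outside [V] is truncated, then projected along an unspecified
   complement of [V]. *)
Definition Vx_of_poly (f : {poly F}) : Vx F q :=
  vsproj (Vx_space F q) (npolyp q.-1 f).

Lemma Vx_of_poly_is_linear : linear Vx_of_poly.
Proof.
move=> a f g; rewrite /Vx_of_poly -linearP; congr vsproj.
apply/val_inj/polyP => i; rewrite /= !(coefD, coefZ, coef_npolyp).
by case: ifP => // _; rewrite mulr0 addr0.
Qed.

HB.instance Definition _ :=
  GRing.isLinear.Build F {poly F} (Vx F q) _ Vx_of_poly Vx_of_poly_is_linear.

Lemma Vx_of_polyK (f : {poly F}) :
  (size f <= q.-1)%N -> f.[0] = 0 -> Vx_poly (Vx_of_poly f) = f.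
Proof.
move=> size_f f0; rewrite /Vx_poly vsprojK ?npolypK //.
by rewrite mem_Vx_space npolypK // f0.
Qed.

Lemma size_horner0_Vx_poly (f : Vx F q) :
  (size (Vx_poly f) <= q.-1)%N /\ (Vx_poly f).[0] = 0.
Proof. by apply/Vx_polyP; exists f. Qed.

Lemma Vx_polyK : cancel (@Vx_poly F q) Vx_of_poly.
Proof.
move=> f; apply: Vx_poly_inj.
by have [size_f f0] := size_horner0_Vx_poly f; rewrite Vx_of_polyK.
Qed.

Lemma mem_lker_A_map (r : F) (f : Vx F q) :
  (f \in lker (A_map q r - \1%VF)) =
  (Vx_poly f \Po ('X + r%:P) == Vx_poly f + (Vx_poly f).[r]%:P).
Proof.
rewrite memv_ker add_lfunE opp_lfunE id_lfunE subr_eq0.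
by rewrite -(inj_eq (@Vx_poly_inj F q)) A_mapE subr_eq.
Qed.

End PolynomialsToVx.

Section Generators.
Variables (F : fieldType) (p n : nat) (b : F).
Hypotheses (p_gt1 : (1 < p)%N) (q_gt2 : (2 < p ^ n)%N).

Definition eigen_generators : seq {poly F} :=
  p_monomials F p n ++ p_binomial_powers p n b.

Definition eigen_span : {vspace Vx F (p ^ n)} :=
  <<map (@Vx_of_poly F (p ^ n)) eigen_generators>>.

Let n_gt0 : (0 < n)%N := ltn_exp_gt0 (ltnW q_gt2).

Lemma eigen_generators_ind (P : {poly F} -> Prop) :
    (forall k, (k < n)%N -> P 'X^(p ^ k)) ->
    (forall i, (0 < i < p ^ n.-1)%N -> P (p_binomial p b ^+ i)) ->
  {in eigen_generators, forall f, P f}.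
Proof.
move=> P_monomial P_power f; rewrite mem_cat => /orP[] /mapP[i].
  by rewrite mem_iota => /P_monomial P_i ->.
rewrite mem_filter mem_index_iota => /and3P[_ i_gt1 lt_i] ->.
by apply: P_power; rewrite lt_i (ltnW i_gt1).
Qed.

Lemma size_horner0_eigen_generators :
  {in eigen_generators, forall f : {poly F},
    (size f <= (p ^ n).-1)%N /\ f.[0] = 0}.
Proof.
have p_gt0 := ltnW p_gt1; apply: eigen_generators_ind => [k lt_kn|i].
  rewrite size_polyXn hornerXn expr0n expn_eq0 eqn0Ngt p_gt0; split=> //.
  by have := ltn_succ_exp p_gt1 q_gt2 lt_kn; lia.
case/andP=> i_gt0 lt_i; split.
  apply: leq_trans (size_poly_exp_leq _ _) _; rewrite size_p_binomial //=.
  have : (p * i.+1 <= p ^ n)%N.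
    by rewrite -(prednK n_gt0) expnS leq_mul2l lt_i orbT.
  by rewrite mulnS; lia.
by rewrite horner_exp horner0_p_binomial // expr0n eqn0Ngt i_gt0.
Qed.

Lemma map_Vx_of_polyK :
  map (@Vx_poly F (p ^ n)) (map (@Vx_of_poly F (p ^ n)) eigen_generators)
    = eigen_generators.
Proof.
rewrite -map_comp; apply: map_id_in => f.
by case/size_horner0_eigen_generators => size_f f0; apply: Vx_of_polyK.
Qed.

Lemma mem_eigen_span_monomial k :
  (k < n)%N -> Vx_of_poly (p ^ n) 'X^(p ^ k) \in eigen_span.
Proof.
move=> lt_kn; apply/memv_span/map_f; rewrite mem_cat; apply/orP; left.
by apply/mapP; exists k; rewrite ?mem_iota.
Qed.

Lemma mem_eigen_span_power i : p \in [pchar F] -> (0 < i < p ^ n.-1)%N ->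
  Vx_of_poly (p ^ n) (p_binomial p b ^+ i) \in eigen_span.
Proof.
move=> pcharFp /andP[i_gt0 lt_i].
have [/(is_powerP _ p_gt1)[k i_eq]|not_power] := boolP (is_power p i).
  have lt_kn : (k.+1 < n)%N.
    by rewrite -(prednK n_gt0) ltnS -(ltn_exp2l _ _ p_gt1) -i_eq.
  rewrite i_eq p_binomial_exp_pchar // linearB linearZ /=.
  by rewrite memvB ?memvZ ?mem_eigen_span_monomial // ltnW.
apply/memv_span/map_f; rewrite mem_cat; apply/orP; right.
apply/mapP; exists i => //; rewrite mem_filter not_power mem_index_iota lt_i.
rewrite andbT /= ltn_neqAle i_gt0 andbT; apply: contra not_power => /eqP <-.
by apply/(is_powerP _ p_gt1); exists 0%N.
Qed.

Lemma mem_eigen_span_comp (h : {poly F}) :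
    p \in [pchar F] -> h.[0] = 0 -> (size h <= p ^ n.-1)%N ->
  Vx_of_poly (p ^ n) (h \Po p_binomial p b) \in eigen_span.
Proof.
move=> pcharFp h0 size_h; rewrite comp_polyE linear_sum memv_suml // => i _.
rewrite linearZ /=; case: (posnP i) => [->|i_gt0].
  by rewrite -horner_coef0 h0 scale0r mem0v.
by rewrite memvZ ?mem_eigen_span_power // i_gt0 (leq_trans (ltn_ord i)).
Qed.

End Generators.

Section Eigenspace.
Variables (F : fieldType) (p n : nat) (r : F).
Hypotheses (pcharFp : p \in [pchar F]) (r_neq0 : r != 0).
Hypothesis q_gt2 : (2 < p ^ n)%N.

Let p_gt1 : (1 < p)%N := prime_gt1 (pcharf_prime pcharFp).
Let n_gt0 : (0 < n)%N := ltn_exp_gt0 (ltnW q_gt2).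

Local Notation b := (r ^+ (p - 1)).
Local Notation g := (p_binomial p b).

Lemma eigen_generators_shift :
  {in eigen_generators p n b, forall f : {poly F},
    f \Po ('X + r%:P) = f + f.[r]%:P}.
Proof.
apply: eigen_generators_ind => [k _|i /andP[i_gt0 _]].
  by rewrite comp_Xn_pchar_shift // hornerXn.
have gi_periodic : shift_periodic r (g ^+ i).
  by rewrite -comp_Xn_poly; apply: comp_p_binomial_periodic.
have := shift_periodic_horner 1 gi_periodic; rewrite mulr1n => ->.
rewrite horner_exp horner0_p_binomial ?(ltnW p_gt1) // expr0n eqn0Ngt i_gt0.
by rewrite addr0.
Qed.

Lemma lker_sub_eigen_span :
  (lker (A_map (p ^ n) r - \1%VF) <= eigen_span p n b)%VS.
Proof.
apply/subvP => f; rewrite mem_lker_A_map => /eqP.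
rewrite -[f in f \in eigen_span _ _ _]Vx_polyK.
have [] := size_horner0_Vx_poly f; move: (Vx_poly f) => u size_u u0 u_shift.
have [h] := shift_addC_comp_p_binomial pcharFp r_neq0 u_shift.
set c := _ / r => u_eq.
have hg_eq : h \Po g = u - c *: 'X by rewrite [in RHS]u_eq addrK.
have h0 : h.[0] = 0.
  have := horner_comp h g 0; rewrite horner0_p_binomial ?(ltnW p_gt1) // => <-.
  by rewrite hg_eq !hornerE u0 subr0.
have size_hg : (size (h \Po g) <= p ^ n)%N.
  rewrite hg_eq (leq_trans (size_polyD _ _)) // size_polyN geq_max.
  rewrite (leq_trans size_u) ?leq_pred //=.
  by rewrite (leq_trans (size_scale_leq _ _)) // size_polyX ltnW.
have size_h : (size h <= p ^ n.-1)%N.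
  apply: (size_comp_p_binomial_leq (b := b) p_gt1).
    by rewrite expn_gt0 (ltnW p_gt1).
  by rewrite -expnSr (prednK n_gt0).
rewrite u_eq linearD linearZ /= memvD ?mem_eigen_span_comp ?memvZ //.
by rewrite -['X]expr1 -(expn0 p) mem_eigen_span_monomial.
Qed.

Lemma eigen_span_sub_lker :
  (eigen_span p n b <= lker (A_map (p ^ n) r - \1%VF))%VS.
Proof.
apply/span_subvP => _ /mapP[f f_gen ->]; rewrite mem_lker_A_map.
have [size_f f0] := size_horner0_eigen_generators p_gt1 q_gt2 f_gen.
by rewrite Vx_of_polyK // eigen_generators_shift.
Qed.

Lemma lker_A_map_sub1 :
  lker (A_map (p ^ n) r - \1%VF) = eigen_span p n b.
Proof.
by apply/eqP; rewrite eqEsubv lker_sub_eigen_span eigen_span_sub_lker.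
Qed.

End Eigenspace.

Theorem theorem2 (p n : nat) (F : finFieldType) (r : F)
    (p_prime : prime p) (q_ge3 : (3 <= p ^ n)%N) (cardF : #|F| = (p ^ n)%N)
    (r_neq0 : r != 0) :
  let b : F := r ^+ (p - 1) in
  ((p ^ n - 1) %/ (p - 1))%N.-unity_root b /\
  exists gens : seq (Vx F (p ^ n)),
    map (@Vx_poly F (p ^ n)) gens
      = p_monomials F p n ++ p_binomial_powers p n b /\
    lker (A_map (p ^ n) r - \1%VF) = <<gens>>%VS.
Proof.
have pcharFp : p \in [pchar F] := card_finPcharP cardF p_prime.
move=> b; split.
  rewrite [(p ^ n - 1)%N]subn1 -cardF; apply: expf_unity_root => //.
  by rewrite cardF predn_exp subn1 dvdn_mulr.
exists (map (@Vx_of_poly F (p ^ n)) (eigen_generators p n b)); split.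
  by apply: map_Vx_of_polyK (prime_gt1 p_prime) q_ge3.
exact: lker_A_map_sub1.
Qed.
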